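(* Let $X$ be a translation invariant Banach lattice on $[0,1]$, let $r\ge2$ be an integer, and let $\varepsilon>0$. Then, for each $S_n\in\mathcal{S}_{r,n}$ and $N\ge(2r^2+\varepsilon)n$, we have $$\|S_n\|_X\asymp\bigg\|\sum_{k=1}^N|S_n(x_k)|\chi_{\left[\frac{k-1}N,\frac kN\right]}\bigg\|_X,$$ where $x_k$ is an arbitrary point in $\left[\frac{k-1}N,\frac kN\right]$, $k=1,\dots,N$.
   Context: $\mathcal{S}_{r,n}$, $r\ge2$, is the set of all 1-periodic spline functions of degree $r-1$ with knots $t_j=j/n$, $j=0,\dots,n$: $S\in\mathcal{S}_{r,n}$ if $S\in C^{r-2}[0,1]$, $S$ is an algebraic polynomial of degree $r-1$ on each interval $(t_{j-1},t_j)$, $j=1,\dots,n$, and $S(t+1)=S(t)$ for $t\in\mathbb{R}$. A Banach (function) lattice $X$ on $[0,1]$ (with a positive $\sigma$-finite measure $\mu$) is a Banach space of functions with a functional $\|\cdot\|_X$ such that: 1) $\|f\|_X=0$ iff $f=0$; 2) $\|\lambda f\|_X=|\lambda|\|f\|_X$ for $\lambda\in\mathbb{C}$; 3) $\|f+g\|_X\le\|f\|_X+\|g\|_X$; 4) if $|f|\le|g|$ then $\|f\|_X\le\|g\|_X$ for $f,g\in X$; 5) $\chi_B\in X$ for all $B$ with $\mu(B)<\infty$; moreover $X\subset L_1$ is assumed. Functions are regarded as 1-periodic, and $X$ is translation invariant if for all $t$ and $f\in X$ one has $f(\cdot+t)\in X$ and $\|f(\cdot+t)\|_X=\|f\|_X$.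 $A\asymp B$ means two-sided inequalities with positive constants independent of the essential variables (here $n$, $N$, $S_n$, and the points $x_k$). *)

(* Defs.v *)
From HB Require Import structures.
From mathcomp Require Export all_boot all_order all_algebra.
From mathcomp Require Export all_classical all_reals all_analysis.
From mathcomp.real_closed Require Export complex.

Set Implicit Arguments.
Unset Strict Implicit.
Unset Printing Implicit Defensive.

Export Order.TTheory GRing.Theory Num.Theory.
Export numFieldNormedType.Exports.

Local Open Scope classical_set_scope.
Local Open Scope ring_scope.
Local Open Scope complex_scope.

Section Defs.
Context {R : realType}.
Implicit Types (mu : {measure set R -> \bar R}) (f g : R -> R[i]).

Definition I01 : set R := `[0, 1]%classic.

(* Complex-valued functions on [0,1], regarded as 1-periodic, are represented
   by 1-periodic functions on the whole line; a measure on [0,1] is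
   represented by a Borel measure on R of which only the restriction to [0,1]
   matters. *)

(* f x = f y whenever x = y modulo 1, so the periodic version of the
   characteristic function of B <= [0,1] takes the value 1 at x iff some
   integer translate of x lies in B. *)
Definition perchi (B : set R) : R -> R[i] :=
  \1_[set x | exists k : int, B (x + k%:~R)].

(* The library has no integral of complex-valued functions: f is in L_1(mu)
   iff its real and imaginary parts are. *)
Definition inL1 mu f :=
  mu.-integrable I01 (fun x => (complex.Re (f x))%:E) /\
  mu.-integrable I01 (fun x => (complex.Im (f x))%:E).

(* The space is the set X of functions together with the functional nm, whose
   values outside X are irrelevant.  As usual in L_p-like spaces, functions
   are identified (and compared) mu-almost everywhere on [0,1]: X is a union
   of classes of functions modulo equality almost everywhere. *)
Record banach_lattice mu (X : set (R -> R[i])) (nm : (R -> R[i]) -> R) : Prop :=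
  BanachLattice {
    bl_periodic : forall f, X f -> periodic f 1 ;
    bl_ae : forall f g, X f -> periodic g 1 ->
      measurable_fun I01 (fun x => complex.Re (g x)) ->
      measurable_fun I01 (fun x => complex.Im (g x)) ->
      {ae mu, forall x : R, I01 x -> f x = g x} -> X g ;
    bl_add : forall f g, X f -> X g -> X (fun x => f x + g x) ;
    bl_scale : forall (l : R[i]) f, X f -> X (fun x => l * f x) ;
    bl_norm0 : forall f, X f ->
      (nm f = 0 <-> {ae mu, forall x : R, I01 x -> f x = 0}) ;
    bl_normZ : forall (l : R[i]) f, X f ->
      nm (fun x => l * f x) = Normc.normc l * nm f ;
    bl_normD : forall f g, X f -> X g ->
      nm (fun x => f x + g x) <= nm f + nm g ;
    bl_mono : forall f g, X f -> X g ->
      {ae mu, forall x : R, I01 x -> `|f x| <= `|g x|} -> nm f <= nm g ;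
    bl_complete : forall u : nat -> R -> R[i], (forall k, X (u k)) ->
      (forall e : R, 0 < e -> exists M : nat, forall k l : nat,
         (M <= k)%N -> (M <= l)%N -> nm (fun x => u k x - u l x) < e) ->
      exists2 f, X f & (fun k => nm (fun x => u k x - f x)) @ \oo --> (0 : R) ;
    bl_chi : forall B : set R, measurable B -> B `<=` I01 ->
      (mu B < +oo)%E -> X (perchi B) ;
    bl_L1 : forall f, X f -> inL1 mu f
  }.

Definition translation_invariant (X : set (R -> R[i])) (nm : (R -> R[i]) -> R) :=
  forall (t : R) f, X f ->
    X (fun x => f (x + t)) /\ nm (fun x => f (x + t)) = nm f.

(* f' is the derivative of f on [0,1], one-sided at the end points: y tends to
   x within [0,1], y != x. *)
Definition derivative01 f (f' : R -> R[i]) :=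
  forall x : R, 0 <= x <= 1 ->
    (fun y : R => (f y - f x) / (y - x)%:C) @ within I01 x^'
      --> (f' x : R[i]^o).

(* f is in C^m[0,1]; this involves the values of f on [0,1] only. *)
Fixpoint C01 (m : nat) f : Prop :=
  {within I01, continuous (f : R -> R[i]^o)} /\
  if m is m'.+1 then exists2 f', derivative01 f f' & C01 m' f' else True.

Definition spline (r n : nat) (S : R -> R[i]) :=
  [/\ C01 (r - 2) S,
      forall j : nat, (j < n)%N -> exists2 p : {poly R[i]}, (size p <= r)%N &
        forall t : R, j%:R / n%:R < t < j.+1%:R / n%:R -> S t = p.[t%:C]
    & periodic S 1].

(* The interval number k, counted from 0: k stands for k - 1 in
   [(k-1)/N, k/N], k = 1, ..., N. *)
Definition subitv (N k : nat) : set R := `[k%:R / N%:R, k.+1%:R / N%:R].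

Definition stepfun (N : nat) (x : 'I_N -> R) (S : R -> R[i]) : R -> R[i] :=
  fun t => \sum_(k < N) `|S (x k)| * perchi (subitv N k) t.

End Defs.

(* Main.v *)
(* A polynomial of degree less than [r] is bounded on an interval by its values
   at [r] separated nodes of that interval (Lagrange interpolation), so a spline
   at a point is bounded by a fixed number of its values at nearby points
   [t + s i], where the shifts [s i] depend on [r] and [n] only and each node may be
   perturbed by [1/(2 r^2 n) >= 1/N].  Hence [|S|] is dominated pointwise by a
   constant times a sum of translates of the step function, and conversely;
   monotonicity, the triangle inequality and translation invariance of the
   norm conclude.

   That [S] lies in [X] at all requires [mu I01 < +oo]; this is forced by
   [X] being translation invariant and contained in [L_1]. *)
From HB Require Import structures.
Require Import Defs.
From mathcomp Require Import ring lra zify qpoly measurable_realfun.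

Set Implicit Arguments.
Unset Strict Implicit.
Unset Printing Implicit Defensive.

Local Open Scope classical_set_scope.
Local Open Scope ring_scope.

(** * The modulus in [R[i]] and the real and imaginary parts *)

Section Complex.
Context {R : realType}.
Local Open Scope complex_scope.

Lemma norm_real_complex (x : R) : `|x%:C| = `|x|%:C.
Proof. by rewrite normc_def /= expr0n addr0 sqrtr_sqr. Qed.

Lemma norm_normc (z : R[i]) : `|z| = (Normc.normc z)%:C.
Proof. by rewrite normc_def; case: z. Qed.

Lemma normc_ge_Im (z : R[i]) : `|complex.Im z|%:C <= `|z|.
Proof.
rewrite norm_normc lecR; case: z => a b /=.
by rewrite -sqrtr_sqr ler_wsqrtr// lerDr sqr_ge0.
Qed.

Lemma norm_Re_le (z : R[i]) (e : R) : `|z| <= e%:C -> `|complex.Re z| <= e.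
Proof. by move=> ze; rewrite -lecR; exact: le_trans (normc_ge_Re z) ze. Qed.

Lemma norm_Im_le (z : R[i]) (e : R) : `|z| <= e%:C -> `|complex.Im z| <= e.
Proof. by move=> ze; rewrite -lecR; exact: le_trans (normc_ge_Im z) ze. Qed.

End Complex.

(** * Splines: polynomial pieces, interpolation and local bounds *)

Section Splines.
Context {R : realType}.
Local Open Scope complex_scope.
Implicit Types (S : R -> R[i]) (x y t : R) (z : nat -> R).

Lemma periodicz (V : zmodType) (S : R -> V) (k : int) x :
  periodic S 1 -> S (x + k%:~R) = S x.
Proof.
move=> perS; case: k => n; first by rewrite -[_%:~R]/(n%:R) (periodicn perS).
by rewrite NegzE -[LHS](periodicn perS n.+1) mulrNz -[_%:~R]/(n.+1%:R) subrK.
Qed.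

(** In the Lagrange formula each basis polynomial at [x] is a product of [r.-1] factors
    [(x - z j) / (z i - z j)], each of modulus at most [b / a]. *)
Lemma interpolation_bound (r : nat) (p : {poly R[i]}) z (a b x : R) :
  (0 < r)%N -> (size p <= r)%N -> 0 < a ->
  (forall i j, i != j -> a <= `|z i - z j|) ->
  (forall i, (i < r)%N -> `|x - z i| <= b) ->
  `|p.[x%:C]| <= ((b / a) ^+ r.-1)%:C * \sum_(i < r) `|p.[(z i)%:C]|.
Proof.
move=> r0 sp a0 za zb.
have zinj : injective (fun i => (z i)%:C).
  move=> i j /(congr1 (@complex.Re _)) /= zij; apply/eqP; apply/negP => /negP.
  by move=> /za; rewrite zij subrr normr0 leNgt a0.
rewrite {1}(lagrange_gen r0 zinj sp) horner_sum mulr_sumr.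
apply: le_trans (ler_norm_sum _ _ _) _; apply: ler_sum => i _.
rewrite hornerM hornerC normrM mulrC ler_wpM2r// lagrangeE//.
rewrite hornerM hornerC !horner_prod -prodfV -big_split /= normr_prod.
under eq_bigr do rewrite !hornerXsubC -!rmorphB -fmorphV -rmorphM norm_real_complex.
rewrite -rmorph_prod lecR.
have -> : r.-1 = #|[pred j : 'I_r | j != i]| by rewrite cardC1 card_ord.
rewrite -prodr_const; apply: ler_prod => j ji.
rewrite normr_ge0 /= normrM mulrC normfV ler_pM// ?invr_ge0//; first exact: zb.
by rewrite lef_pV2 ?posrE// ?(lt_le_trans a0)// za// eq_sym.
Qed.

Lemma real_complex_continuous : continuous ((fun x : R => x%:C) : R -> R[i]^o).
Proof.
move=> x; apply/(@cvgrPdist_lt R[i] R[i]^o) => e e0.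
(* In the partial order of [R[i]], [0 < e] forces [e] to be real. *)
have eE : e = (complex.Re e)%:C.
  by case: e e0 => a b /=; rewrite ltcE /= => /andP[/eqP -> _].
near=> y.
rewrite -rmorphB /= norm_real_complex eE ltcR.
near: y; apply: (@cvgr_dist_lt _ R^o) => //.
by rewrite -ltcR -eE.
Unshelve. all: by end_near. Qed.

Lemma horner_continuous (p : {poly R[i]}) :
  continuous ((fun x : R => p.[x%:C]) : R -> R[i]^o).
Proof.
elim/poly_ind: p => [|p c IH] x.
  under eq_fun do rewrite horner0; exact: cvg_cst.
under eq_fun do rewrite hornerMXaddC.
apply: (@cvgD _ R[i]^o); last exact: cvg_cst.
apply: (@cvgM R[i]); [exact: IH|exact: real_complex_continuous].
Qed.

(** At [u] and [v] the one-sided limits of [f] and of [p] from inside the interval agree. Continuity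
    within [I01] provides them also when [u = 0] or [v = 1], where only one side is available. *)
Lemma eq_horner_itvcc (f : R -> R[i]) (p : {poly R[i]}) (u v : R) :
  {within I01, continuous (f : R -> R[i]^o)} -> 0 <= u -> u < v -> v <= 1 ->
  (forall t, u < t < v -> f t = p.[t%:C]) ->
  forall t, u <= t <= v -> f t = p.[t%:C].
Proof.
move=> /continuous_within_itvP; rewrite ltr01 => /(_ isT)[fc f0 f1] u0 uv v1 fp.
have fr : f x @[x --> u^'+] --> (f u : R[i]^o).
  move: u0; rewrite le_eqVlt => /orP[/eqP u0|u0]; first by rewrite -u0; exact: f0.
  apply: (@cvg_at_right_filter R R[i]^o f); apply: fc; rewrite in_itv /= u0/=.
  exact: lt_le_trans v1.
have fl : f x @[x --> v^'-] --> (f v : R[i]^o).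
  move: v1; rewrite le_eqVlt => /orP[/eqP v1|v1]; first by rewrite v1; exact: f1.
  apply: (@cvg_at_left_filter R R[i]^o f); apply: fc; rewrite in_itv /= v1 andbT.
  exact: le_lt_trans uv.
move=> t /andP[]; rewrite le_eqVlt => /orP[/eqP <- _|ut].
  have h := @cvg_at_right_filter R R[i]^o _ _ _ (@horner_continuous p u).
  apply: (cvg_unique (@norm_hausdorff _ R[i]^o) fr); apply: cvg_trans h.
  apply: near_eq_cvg; near=> s; rewrite fp//; apply/andP; split => //.
rewrite le_eqVlt => /orP[/eqP ->|tv]; last by rewrite fp// ut.
have h := @cvg_at_left_filter R R[i]^o _ _ _ (@horner_continuous p v).
apply: (cvg_unique (@norm_hausdorff _ R[i]^o) fl); apply: cvg_trans h.
by apply: near_eq_cvg; near=> s; rewrite fp//; apply/andP; split.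
Unshelve. all: by end_near. Qed.

(** Writing [j = q * n + k] with [0 <= k < n], periodicity carries the piece number [k] to the piece
    number [j] by composing its polynomial with ['X - q]. Continuity adds the knots to the open
    intervals. *)
Lemma spline_horner (r n : nat) S : (0 < n)%N -> spline r n S ->
  forall j : int, exists2 p : {poly R[i]}, (size p <= r)%N &
    forall t, j%:~R / n%:R <= t <= (j + 1)%:~R / n%:R -> S t = p.[t%:C].
Proof.
move=> n0 [C Sp perS] j.
have cS : {within I01, continuous (S : R -> R[i]^o)} by case: (r - 2)%N C => [|m] [].
have nz : (n : int) != 0 by rewrite lt0r_neq0.
have nR : n%:R != 0 :> R by rewrite pnatr_eq0 -lt0n.
have nR0 : 0 < n%:R :> R by rewrite ltr0n.
have := modz_ge0 j nz; have := ltz_pmod j (d := n) n0.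
have := divz_eq j n.
set q := (j %/ n)%Z; case: (j %% n)%Z => // k jE; rewrite ltz_nat => kn _.
have [p sp pS] := Sp k kn.
have pS' := @eq_horner_itvcc S p (k%:R / n%:R) (k.+1%:R / n%:R) cS.
exists (p \Po ('X - q%:~R%:P)); first by rewrite size_comp_poly2// size_XsubC.
move=> t /andP[t1 t2].
rewrite horner_comp hornerXsubC -[t](subrK q%:~R) periodicz// pS' ?addrK.
- by rewrite subrK rmorphB /= rmorph_int.
- by rewrite divr_ge0.
- by rewrite ltr_pM2r ?invr_gt0// ltr_nat.
- by rewrite ler_pdivrMr// mul1r ler_nat.
- exact: pS.
- move: t1 t2; rewrite jE ler_pdivrMr// ler_pdivlMr// !rmorphD /= rmorphM /= => t1 t2.
  rewrite ler_pdivrMr// ler_pdivlMr// mulrBl -natr1.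
  move: t1 t2; rewrite -!pmulrn => t1 t2; lra.
Qed.

Lemma separated_perturbation (z : nat -> R) (c d e : R) :
  0 <= d -> (forall i, `|z i - (c + i%:R * d)| <= e) ->
  forall i j, i != j -> d - 2 * e <= `|z i - z j|.
Proof.
move=> d0 ze; suff H i j : (i < j)%N -> d - 2 * e <= `|z i - z j|.
  by move=> i j; rewrite neq_ltn => /orP[/H//|/H]; rewrite distrC.
move=> ij; rewrite distrC; apply: le_trans (ler_norm _).
move: (ze i) (ze j); rewrite !ler_distl => /andP[_ zi] /andP[zj _].
suff : d <= j%:R * d - i%:R * d by lra.
by rewrite -mulrBl ler_peMl// -natrB ?(ltnW ij)// ler1n subn_gt0.
Qed.

(* A knot interval meeting [[t - 1/n, t + 1/n]], shortened at both ends by the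
   tolerance [1/(2 r^2 n)], contains [r] consecutive nodes [t + (i dl - 3) / n] when
   [r dl = 1 - 1/r^2]; the perturbed nodes stay separated because [dl > 1/r^2].
   The offset [-3] is there to have nonnegative indices [i]. *)
Lemma spline_bound (r : nat) : (2 <= r)%N ->
  exists (dl : R) (M : nat) (L : R), 0 < L /\
    forall (n : nat) S t x z, (0 < n)%N -> spline r n S ->
      `|x - t| <= n%:R^-1 ->
      (forall i, `|z i - (t + (i%:R * dl - 3) / n%:R)| <= (2 * r%:R ^+ 2 * n%:R)^-1) ->
      `|S x| <= L%:C * \sum_(i < M) `|S (z i)|.
Proof.
move=> r2; have r2R : 2 <= r%:R :> R by rewrite ler_nat.
have r0 : 0 < r%:R :> R by lra.
(* In units of [1/n], [e] is the tolerance on the nodes and [dl] their spacing. *)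
pose e : R := (2 * r%:R ^+ 2)^-1; pose dl : R := (1 - 2 * e) / r%:R.
have e0 : 0 < e by rewrite invr_gt0; nra.
have sep : 0 < dl - 2 * e.
  have -> : dl - 2 * e = (r%:R ^+ 2 - r%:R - 1) / r%:R ^+ 3.
    by rewrite /dl /e; field; lra.
  by rewrite divr_gt0 ?exprn_gt0//; nra.
have dl0 : 0 < dl by lra.
have rdl : r%:R * dl = 1 - 2 * e by rewrite /dl; field; lra.
(* The first node used will have an index [i0 < w + 1] with [w <= 5 / dl]; [r] consecutive indices
   are used from there on. *)
pose M := (Num.trunc (5 / dl) + r + 2)%N.
exists dl, M, ((dl - 2 * e)^-1 ^+ r.-1); split; first by rewrite exprn_gt0// invr_gt0.
move=> n S t x z n0 Sp xt zt.
have nR : 0 < n%:R :> R by rewrite ltr0n.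
have n'0 : 0 < n%:R^-1 :> R by rewrite invr_gt0.
have nn : n%:R^-1 * n%:R = 1 :> R by rewrite mulVf// gt_eqF.
have [p sp pS] := spline_horner n0 Sp (Num.floor (x * n%:R)).
set j := Num.floor (x * n%:R) in pS.
have /andP[jx xj] : j%:~R <= x * n%:R < (j + 1)%:~R := floor_itv (x * n%:R).
have pS' y : j%:~R <= y * n%:R <= (j + 1)%:~R -> S y = p.[y%:C].
  by move=> ?; apply: pS; rewrite ler_pdivrMr// ler_pdivlMr.
rewrite rmorphD /= rmorph1 in xj pS'.
have /andP[tx1 tx2] : t * n%:R - 1 <= x * n%:R <= t * n%:R + 1.
  move: xt; rewrite ler_distl -(ler_pM2r nR) -(ler_pM2r nR x).
  by rewrite mulrBl mulrDl nn.
have zt' i : `|z i * n%:R - (t * n%:R - 3 + i%:R * dl)| <= e.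
  have := zt i; rewrite invfM -/e => /(ler_wpM2r (ltW nR)).
  rewrite -mulrA nn mulr1 -{2}(gtr0_norm nR) -normrM mulrBl; congr (`|_ - _| <= _).
  by field; rewrite gt_eqF.
(* At the real index [w] the unperturbed node lies exactly [e / n] to the right of the knot [j / n];
   [i0] is [w] rounded up. Since [j > x * n - 1 >= t * n - 2], the offset 3 makes [w]
   nonnegative. *)
pose w := (j%:~R + e + 3 - t * n%:R) / dl.
have w0 : 0 <= w by rewrite divr_ge0 ?(ltW dl0)//; lra.
have [i0 /andP[iw wi]] : exists i0 : nat, w <= i0%:R < w + 1.
  have /andP[h1 h2] := ceil_itv w.
  have := ceil_ge0 w; rewrite (lt_le_trans _ w0)// ?ltrN10//.
  case: (Num.ceil w) h1 h2 => // k h1 h2 _; exists k; apply/andP; split => //.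
  by move: h1; rewrite rmorphB /= ltrBlDr.
have iM : (i0 + r <= M)%N.
  have : i0%:R < (Num.trunc (5 / dl)).+1%:R + 1 :> R.
    apply: lt_le_trans wi _; rewrite lerD2r; apply: (le_trans _ (ltW (truncnS_gt _))).
    rewrite ler_pM2r ?invr_gt0//.
    have : e <= 1 by rewrite invf_le1; nra.
    lra.
  by rewrite natr1 ltr_nat /M addnAC leq_add2r addn2 => /ltnW.
(* The perturbation costs at most [e] at each end, and the nodes number [i0] to [i0 + r - 1] start
   less than [dl] after index [w] and span [(r - 1) * dl]; so they fit because
   [2 * e + r * dl = 1]. *)
have zJ l : (l < r)%N -> j%:~R <= z (i0 + l)%N * n%:R <= j%:~R + 1.
  move=> lr; have := zt' (i0 + l)%N; rewrite ler_distl natrD mulrDl => /andP[z1 z2].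
  have lr' : l%:R * dl <= r%:R * dl - dl.
    by rewrite -[X in _ - X]mul1r -mulrBl ler_pM2r// lerBrDr natr1 ler_nat.
  have l0 : 0 <= l%:R * dl by rewrite mulr_ge0// ltW.
  move: iw wi; rewrite -(ler_pM2r dl0) -(ltr_pM2r dl0) mulrDl divfK ?gt_eqF// => iw wi.
  by apply/andP; split; lra.
have xS : S x = p.[x%:C] by apply: pS'; rewrite jx ltW.
(* Separation and diameter both scale like [1/n], so the constant obtained does not depend on
   [n]. *)
have := @interpolation_bound r p (fun l => z (i0 + l)%N)
  ((dl - 2 * e) / n%:R) (n%:R^-1) x (ltnW r2) sp.
have -> : n%:R^-1 / ((dl - 2 * e) / n%:R) = (dl - 2 * e)^-1.
  by field; rewrite !gt_eqF.
move=> /(_ _ _ _)/wrap[]//.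
- by rewrite divr_gt0.
- move=> i k ik; rewrite ler_pdivrMr// -[in leRHS](gtr0_norm nR) -normrM mulrBl.
  apply: (separated_perturbation (ltW dl0) zt').
  by rewrite eqn_add2l.
- move=> i /zJ /andP[z1 z2].
  rewrite -(ler_pM2r nR) nn -[in leLHS](gtr0_norm nR) -normrM mulrBl ler_norml.
  by apply/andP; split; lra.
rewrite -xS => /le_trans; apply.
rewrite ler_wpM2l ?ler0c ?exprn_ge0 ?invr_ge0 ?(ltW sep)//.
rewrite (eq_bigr (fun l : 'I_r => `|S (z (i0 + l)%N)|)); last first.
  by move=> l _; rewrite pS'// zJ.
have -> : \sum_(l < r) `|S (z (i0 + l)%N)| = \sum_(i0 <= l < i0 + r) `|S (z l)|.
  rewrite -{2}[i0]add0n big_addn addnC addnK big_mkord.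
  by apply: eq_bigr => l _; rewrite addnC.
rewrite -(big_mkord xpredT (fun l => `|S (z l)|)).
rewrite (@big_cat_nat _ _ _ i0 0%N M)//=; last first.
  by apply: leq_trans iM; rewrite leq_addr.
rewrite (@big_cat_nat _ _ _ (i0 + r)%N i0 M)//= ?leq_addr// addrCA.
by rewrite lerDl addr_ge0// sumr_ge0.
Qed.

(** By periodicity [x] may be taken in [[0, 1)]. With [t = m / n] the knot just before [x] and
    unperturbed nodes, [spline_bound] involves only finitely many values of [S], as [m < n]; [K]
    sums over all of them. *)
Lemma spline_bounded (r n : nat) S : (2 <= r)%N -> (0 < n)%N -> spline r n S ->
  exists K : R, forall x, `|S x| <= K%:C.
Proof.
move=> r2 n0 Sp; have [dl [M [L [L0 SL]]]] := spline_bound r2.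
have perS : periodic S 1 by case: Sp.
have nR : 0 < n%:R :> R by rewrite ltr0n.
pose s i : R := (i%:R * dl - 3) / n%:R.
pose K := L * \sum_(m < n) \sum_(i < M) Normc.normc (S (m%:R / n%:R + s i)).
exists K => y.
rewrite -(periodicz (- Num.floor y) _ perS) rmorphN.
have := floor_itv y; set x := y + _ => /andP[y1 y2].
have x0 : 0 <= x by rewrite /x subr_ge0.
have x1 : x < 1 by rewrite /x ltrBlDl -[1]/(1%:~R) -rmorphD.
have xn : 0 <= x * n%:R by rewrite mulr_ge0// ltW.
have /andP[m1 m2] := truncn_itv xn.
have mn : (Num.trunc (x * n%:R) < n)%N by rewrite truncn_lt_nat// gtr_pMl.
set m := Num.trunc _ in m1 m2 mn.
have := SL n S (m%:R / n%:R) x (fun i => m%:R / n%:R + s i) n0 Sp.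
move=> /(_ _ _)/wrap[].
- rewrite -(ler_pM2r nR) mulVf ?gt_eqF// -[X in _ * X <= _](gtr0_norm nR).
  rewrite -normrM mulrBl divfK ?gt_eqF//.
  by rewrite -natr1 in m2; rewrite ler_norml; apply/andP; split; lra.
- by move=> i; rewrite subrr normr0 invr_ge0 !mulr_ge0// exprn_ge0.
move=> /le_trans; apply; rewrite /K rmorphM /= ler_wpM2l ?ler0c ?(ltW L0)//.
rewrite rmorph_sum (bigD1 (Ordinal mn)) //= rmorph_sum /=.
under eq_bigr do rewrite norm_normc.
rewrite lerDl sumr_ge0// => i _; rewrite rmorph_sum sumr_ge0// => j _ /=.
by rewrite -norm_normc.
Qed.

End Splines.

(** * Pointwise comparison of the step function with nearby values of the spline *)

Section StepFunctions.
Context {R : realType}.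
Local Open Scope complex_scope.
Implicit Types (S : R -> R[i]) (y z : R).

Lemma stepfunE (N : nat) (x : 'I_N -> R) S y :
  stepfun x S y = \sum_(k < N | `[< exists m : int, subitv N k (y + m%:~R) >]) `|S (x k)|.
Proof.
rewrite /stepfun [RHS]big_mkcond; apply: eq_bigr => k _.
rewrite /perchi indicE; case: asboolP => h.
  by rewrite mem_set// mulr1.
by rewrite memNset// mulr0.
Qed.

Lemma subitvE (N k : nat) y : (0 < N)%N ->
  subitv N k y = (k%:R <= y * N%:R <= k%:R + 1) :> Prop.
Proof.
move=> N0; have NR : 0 < N%:R :> R by rewrite ltr0n.
by rewrite /subitv /= in_itv /= ler_pdivrMr// ler_pdivlMr// natr1.
Qed.

Lemma subitv_dist (N k : nat) y z : (0 < N)%N ->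
  subitv N k y -> subitv N k z -> `|y - z| <= N%:R^-1.
Proof.
move=> N0; have NR : 0 < N%:R :> R by rewrite ltr0n.
rewrite !subitvE// => /andP[y1 y2] /andP[z1 z2].
rewrite -(ler_pM2r NR) mulVf ?gt_eqF// -[in leLHS](gtr0_norm NR) -normrM mulrBl.
by rewrite ler_norml; apply/andP; split; lra.
Qed.

(** If [Num.floor (y * N) = m * N + k] with [0 <= k < N], then [y - m] lies in the subinterval
    number [k]. Its term is one of the nonnegative terms of the step function at [y], and [z] is its
    sample point moved by [m]. *)
Lemma stepfun_ge (N : nat) (x : 'I_N -> R) S y : (0 < N)%N -> periodic S 1 ->
  (forall k : 'I_N, subitv N k (x k)) ->
  exists2 z, `|z - y| <= N%:R^-1 & `|S z| <= stepfun x S y.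
Proof.
move=> N0 perS xN.
have := floor_itv (y * N%:R); set q := Num.floor _ => /andP[q1 q2].
have := divz_eq q N; have := ltz_pmod q (d := N) N0.
have := @modz_ge0 q N; rewrite gt_eqF// => /(_ isT).
case: (q %% N)%Z => // k _; rewrite ltz_nat => kN.
set m := (q %/ N)%Z => qE; pose k' := Ordinal kN.
have ym : subitv N k' (y + (- m)%:~R).
  move: q1 q2; rewrite subitvE// qE /= rmorphN /= !rmorphD /= rmorphM /= mulrBl -!pmulrn.
  by move=> q1 q2; apply/andP; split; lra.
exists (x k' + m%:~R).
  rewrite -[y](subrK m%:~R) opprD addrACA subrr addr0 -mulrNz.
  exact: subitv_dist ym.
rewrite periodicz// stepfunE (bigD1 k') /=; last by apply/asboolP; exists (- m).
by rewrite lerDl sumr_ge0.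
Qed.

(** The closed subintervals share end points, so two of them may contain [y] modulo 1. If [y + m]
    lies in the one number [k], then [Num.floor (y * N)] is [k - m * N] or [k - m * N + 1], which
    determines [k] modulo [N] in either case. *)
Lemma card_subitv (N : nat) y : (0 < N)%N ->
  (#|[pred k : 'I_N | `[< exists m : int, subitv N k (y + m%:~R)%R >]]| <= 2)%N.
Proof.
move=> N0; set q := Num.floor (y * N%:R).
have HN a : (`|(a %% N)%Z| < N)%N.
  by rewrite -ltz_nat gez0_abs ?modz_ge0 ?gt_eqF// ltz_pmod.
have c2 : (#|[set Ordinal (HN q); Ordinal (HN (q - 1)%R)]%SET| <= 2)%N.
  by rewrite cards2; case: (_ != _).
apply: leq_trans c2; apply: subset_leq_card; apply/fintype.subsetP => k.
rewrite inE => -[m].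
rewrite subitvE// mulrDl => /andP[h1 h2].
have q1 : k%:Z - m * N <= q.
  by rewrite floor_ge_int rmorphB rmorphM /= -!pmulrn; lra.
have q2 : q <= k%:Z - m * N + 1.
  rewrite -(ler_int R); apply: le_trans (floor_le _) _.
  by rewrite rmorphD rmorphB rmorphM /= -!pmulrn; lra.
have Hk a : a = k%:Z - m * N -> k = Ordinal (HN a).
  move=> aE; apply/val_inj => /=.
  by rewrite aE -mulNr addrC modzMDl modz_nat modn_small.
have [qE|qE] : q = k%:Z - m * N \/ q - 1 = k%:Z - m * N by lia.
  by rewrite !inE [X in X == _](Hk _ qE) eqxx.
by rewrite !inE orbC [X in X == _](Hk _ qE) eqxx.
Qed.

(** At most two terms are present at [y], each the value of [|S|] at a point within [1/N] of [y]
    modulo 1. *)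
Lemma stepfun_le (N : nat) (x : 'I_N -> R) S y (W : R[i]) :
  (0 < N)%N -> periodic S 1 -> 0 <= W -> (forall k : 'I_N, subitv N k (x k)) ->
  (forall z, `|z - y| <= N%:R^-1 -> `|S z| <= W) ->
  stepfun x S y <= 2 * W.
Proof.
move=> N0 perS W0 xN SW; rewrite stepfunE.
apply: (@le_trans _ _ (\sum_(k < N | `[< exists m : int, subitv N k (y + m%:~R) >]) W)).
  apply: ler_sum => k /asboolP [m ym].
  rewrite -(periodicz (- m) _ perS) SW// rmorphN /= -addrA -opprD [m%:~R + _]addrC.
  exact: subitv_dist ym.
by rewrite sumr_const -[leLHS]mulr_natl ler_wpM2r// ler_nat card_subitv.
Qed.

Lemma stepfun_ge0 (N : nat) (x : 'I_N -> R) S y : 0 <= stepfun x S y.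
Proof. by rewrite stepfunE sumr_ge0. Qed.

End StepFunctions.

(** * Finiteness of the measure of [[0, 1]], from finiteness of translates *)

Section Finiteness.
Context {R : realType}.
Local Notation leb := (@lebesgue_measure R).
Implicit Types (A B : set R).

(** The set of which [perchi B] is the indicator function. *)
Definition periodization B : set R := [set x | exists k : int, B (x + k%:~R)].

Lemma measurable_shift (a : R) : measurable_fun setT (fun x : R => x + a).
Proof. exact: measurable_funD. Qed.

Lemma measurable_preimage_shift A (a : R) :
  measurable A -> measurable ((fun x : R => x + a) @^-1` A).
Proof.
move=> mA; rewrite -[X in measurable X]setTI.
exact: measurable_shift.
Qed.

Lemma measurable_periodization B : measurable B -> measurable (periodization B).
Proof.
move=> mB; rewrite (_ : periodization B =
    \bigcup_(k : int) ((fun x : R => x + k%:~R) @^-1` B)); last first.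
  by apply/seteqP; split => [x [k Bk]|x [k _ Bk]]; exists k.
by apply: countable_bigcupT_measurable => // k; exact: measurable_preimage_shift.
Qed.

(** The image of Lebesgue measure under a translation has the same values on half-open intervals,
    hence is Lebesgue measure by uniqueness. *)
Lemma lebesgue_measure_shift A (a : R) : measurable A ->
  leb ((fun x => x + a) @^-1` A) = leb A.
Proof.
move=> mA; pose f := (fun x : R => x + a) : R -> measurableTypeR R.
have mf : measurable_fun setT f by exact: measurable_shift.
pose F : {mfun R >-> measurableTypeR R} := HB.pack f (isMeasurableFun.Build _ _ _ _ f mf).
rewrite (_ : _ @^-1` _ = F @^-1` A)//; apply/esym.
apply: (@lebesgue_measure_unique _ (pushforward leb F)) => // _ [[u v]] _ <-.
have pre : F @^-1` `]u, v]%classic = `](u - a), (v - a)]%classic.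
  by apply/seteqP; split => x; rewrite /F/= /f !in_itv /= ltrBlDr lerBrDr.
rewrite -[RHS]/(leb (F @^-1` `]u, v]%classic)) pre.
by rewrite !lebesgue_measure_itv/= !lte_fin ltrD2r -!EFinB opprB addrA subrK.
Qed.

Lemma lebesgue_measure_itv01 : leb `[0, 1[%classic = 1%E.
Proof. by rewrite lebesgue_measure_itv/= lte_fin ltr01 oppr0 adde0. Qed.

(** By continuity from below the measures tend to 1, so they cannot all stay at most 1/2. *)
Lemma lebesgue_exhaustion (G : nat -> set R) : (forall i, measurable (G i)) ->
  {homo G : i j / (i <= j)%N >-> (i <= j)%O} -> \bigcup_i G i = `[0, 1[%classic ->
  exists i, (2^-1%:E < leb (G i))%E.
Proof.
move=> mG homoG UG; apply: contrapT => /forallNP nG.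
have := @nondecreasing_cvg_mu _ _ _ leb G mG.
rewrite UG => /(_ (measurable_itv _) homoG) h.
have : (limn (leb \o G) <= 2^-1%:E)%E.
  apply: lime_le; first by apply/cvg_ex; eexists; exact: h.
  by apply: nearW => i; rewrite leNgt; exact/negP/nG.
rewrite (cvg_lim _ h)// => {}h.
have {h} : (leb `[0%R, 1%R[%classic <= 2^-1%:E)%E := h.
by rewrite lebesgue_measure_itv01 lee_fin leNgt invf_lt1 ?ltr1n.
Qed.

(** Rotation of the circle: [B] is cut at [x], the right part is moved by [- x] and the left part by
    [1 - x]. The images are disjoint, lying in [[0, 1 - x)] and [[1 - x, 1)]. *)
Lemma lebesgue_periodization B (x : R) : measurable B -> B `<=` `[0, 1[%classic ->
  0 <= x <= 1 ->
  (leb B <= leb (`[0%R, 1%R[%classic `&` [set t | periodization B (x + t)%R]))%E.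
Proof.
move=> mB B01 /andP[x0 x1].
have mE : measurable [set t | periodization B (x + t)%R].
  under eq_fun do rewrite addrC.
  exact: (measurable_preimage_shift _ (measurable_periodization mB)).
set B1 := B `&` `[x, +oo[%classic; set B2 := B `&` `]-oo, x[%classic.
have mB1 : measurable B1 by exact: measurableI.
have mB2 : measurable B2 by exact: measurableI.
have BE : B = B1 `|` B2.
  rewrite -setIUr -[LHS]setIT; congr (_ `&` _); apply/seteqP; split => // t _ /=.
  by rewrite !in_itv /= andbT; case: (leP x t); [left|right].
have -> : leb B = (leb B1 + leb B2)%E.
  rewrite {1}BE measureU//; apply/seteqP; split => // t [[_ /= h1] [_ /= h2]].
  by move: h1 h2; rewrite !in_itv /= ?andbT => h1; rewrite ltNge h1.
rewrite -(lebesgue_measure_shift x mB1) -(lebesgue_measure_shift (x - 1) mB2).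
rewrite -measureU; [|exact: measurable_preimage_shift|exact: measurable_preimage_shift|].
- apply: le_measure; rewrite ?inE.
  + by apply: measurableU; exact: measurable_preimage_shift.
  + exact: measurableI.
  move=> t [] [Bt] /=; have := B01 _ Bt; rewrite /= !in_itv /= => t01 tx.
    split; first by lra.
    by exists 0; rewrite addr0 addrC.
  split; first by lra.
  by exists (-1); rewrite mulrNz mulr1z -addrA addrCA.
- apply/seteqP; split => // t [[+ _] [+ _]] => /B01 + /B01.
  by rewrite /= !in_itv /=; lra.
Qed.

Lemma measurable_I01 : measurable (I01 : set R).
Proof. exact: measurable_itv. Qed.

(* Take [B] with [mu B < +oo] and [leb B > 1/2], then a set [T] of translations with
   [leb T > 1/2] on which the measure of the translate of [B] is at most some [k].
   By Tonelli on [I01 * T], [k >= (leb B + leb T - 1) * mu I01]. *)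
Lemma finite_measure_of_translates (mu : {measure set R -> \bar R}) :
  sigma_finite I01 mu ->
  (forall B, measurable B -> B `<=` I01 -> (mu B < +oo)%E ->
     forall t, (mu (I01 `&` [set x | periodization B (x + t)%R]) < +oo)%E) ->
  (mu I01 < +oo)%E.
Proof.
move=> [F UF mF] tr.
pose G i := `[0, 1[%classic `&` \big[setU/set0]_(k < i) F k.
have I01S : `[0, 1[%classic `<=` (I01 : set R).
  by apply: subset_itvl; rewrite bnd_simp.
have mFU i : measurable (\big[setU/set0]_(k < i) F k).
  by apply: bigsetU_measurable => k _; case: (mF k).
have mG i : measurable (G i) by exact: measurableI.
have Goo i : (mu (G i) < +oo)%E.
  apply: le_lt_trans (_ : (mu (\big[setU/set0]_(k < i) F k) < +oo)%E).
    by apply: measureIr => //; exact: measurable_itv.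
  elim: i => [|i IH]; first by rewrite big_ord0 measure0.
  rewrite big_ord_recr /=. apply: le_lt_trans (measureU2 mu (mFU i) (mF i).1) _.
  by apply: lte_add_pinfty => //; case: (mF i).
have [||i Gi] := lebesgue_exhaustion mG.
- move=> i j ij; apply/subsetPset; rewrite /G -!bigcup_mkord; apply: setIS.
  by apply: bigcup_sub => k /= ki; apply: bigcup_sup => //=; exact: leq_trans ki ij.
- rewrite -setI_bigcupr -[RHS]setIT; apply/seteqP; split => t [t01 _]; split => //.
  have := I01S _ t01; rewrite UF => -[k _ Fk].
  by exists k.+1 => //; rewrite -bigcup_mkord; exists k => /=.
set B := G i in Gi; have mB : measurable B := mG i.
have B01 : B `<=` `[0, 1[%classic by move=> t [].
have mI := measurable_I01.
(* Tonelli requires a measure that is sigma-finite on the whole line: [mu] is restricted to [I01],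
   and the complement of [I01], now null, is added to the covering sets. *)
pose m1 := mrestr mu mI.
have sm1 : sigma_finite setT m1.
  exists (fun i => if i is i'.+1 then F i' else ~` I01).
    apply/seteqP; split => // t _.
    have [It|It] := pselect (I01 t); last by exists 0%N.
    by move: It; rewrite UF => -[k _ Fk]; exists k.+1.
  case=> [|k]; rewrite /m1 /mrestr.
    by split; [exact: measurableC|rewrite setICl measure0].
  case: (mF k) => mFk Fk; split => //.
  by apply: le_lt_trans Fk; exact: measureIl.
pose M1 : {sigma_finite_measure set R -> \bar R} :=
  HB.pack m1 (Measure_isSigmaFinite.Build _ _ _ m1 sm1).
pose Q := [set z : R * measurableTypeR R | periodization B (z.1 + z.2)].
have mQ : measurable Q.
  have mf : measurable_fun setT (fun z : R * measurableTypeR R => (z.1 : R) + z.2).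
    apply: measurable_funD; [exact: measurable_fst|exact: measurable_snd].
  by rewrite -[Q]setTI; apply: mf => //; exact: measurable_periodization.
(* [H t] is the measure of the translate of [B] by [t]; it is finite for each [t], so the sublevel
   sets [T k] exhaust [[0, 1)]. *)
pose H (t : measurableTypeR R) := M1 (ysection Q t).
have mH : measurable_fun setT H by exact: measurable_fun_ysection.
have Hoo t : (H t < +oo)%E.
  have := tr B mB (subset_trans B01 I01S) (Goo i) t.
  rewrite /H /M1 /= /m1 /mrestr setIC; congr (mu (_ `&` _) < _)%E.
  by apply/seteqP; split => x; rewrite /= /ysection /= inE.
pose T k := `[0, 1[%classic `&` [set t | (H t <= k%:R%:E)%E].
have mT k : measurable (T k).
  by apply: measurable_lee => //; exact: measurable_funTS.
have [||k Tk] := lebesgue_exhaustion mT.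
- move=> k l kl; apply/subsetPset; apply: setIS => t /= Ht.
  by apply: le_trans Ht _; rewrite lee_fin ler_nat.
- rewrite -setI_bigcupr -[RHS]setIT; apply/seteqP; split => t [t01 _]; split => //.
  exists (Num.trunc (fine (H t))).+1 => //=.
  rewrite -[leLHS]fineK ?ge0_fin_numE//= lee_fin.
  exact/ltW/truncnS_gt.
pose A := Q `&` (setT `*` T k).
have mA : measurable A by apply: measurableI => //; apply: measurableX => //; exact: mT.
have := indic_fubini_tonelli M1 (@lebesgue_measure R) mA.
rewrite (indic_fubini_tonelli_FE _ mA) (indic_fubini_tonelli_GE _ mA) => FG.
have le01 (D : set R) : measurable D -> D `<=` `[0, 1[%classic -> (leb D <= 1)%E.
  by move=> mD D01; rewrite -lebesgue_measure_itv01 le_measure ?inE.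
have fin01 (D : set R) : measurable D -> D `<=` `[0, 1[%classic ->
    (fine (leb D))%:E = leb D.
  move=> mD D01; rewrite fineK// ge0_fin_numE//.
  by apply: le_lt_trans (le01 D mD D01) _; rewrite ltry.
have T01 : T k `<=` `[0, 1[%classic by move=> t [].
have mTk := mT k.
(* By inclusion and exclusion inside [[0, 1)], [c] is a lower bound for the measure of [T k]
   intersected with a rotated copy of [B]. *)
pose c := fine (leb B) + fine (leb (T k)) - 1.
have c0 : 0 < c.
  have : 2^-1 < fine (leb B) by rewrite -lte_fin fin01.
  have : 2^-1 < fine (leb (T k)) by rewrite -lte_fin fin01.
  rewrite /c; lra.
(* The sections at fixed [y] have measure at most [k] for [y] in [T k] and are empty otherwise,
   while [T k] has length at most 1. *)
have ub : (\int[@lebesgue_measure R]_y (M1 \o ysection A) y <= k%:R%:E)%E.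
  apply: (@le_trans _ _ (\int[@lebesgue_measure R]_y ((cst k%:R%:E) \_ (T k)) y)%E).
    apply: ge0_le_integral => //.
    - exact: measurable_fun_ysection.
    - by apply/(measurable_restrictT _ (mT k)); exact: measurable_cst.
    - move=> y _ /=; rewrite patchE; case: ifPn => [|yT].
        rewrite inE => -[_ /=]; apply: le_trans.
        rewrite /H; apply: le_measure; rewrite ?inE;
          [exact: measurable_ysection|exact: measurable_ysection|].
        by move=> x; rewrite /ysection /= !inE => -[].
      have -> : ysection A y = set0.
        apply/seteqP; split => // x; rewrite /ysection /= inE => -[_ [_ /= yT']].
        by move: yT; rewrite notin_setE.
      by rewrite -[leLHS]/(M1 set0) measure0.
  rewrite -integral_mkcond integral_cst//.
  by rewrite -[leRHS]mule1 lee_wpmul2l// ?lee_fin// le01.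
have lb : (c%:E * mu I01 <= \int[M1]_x (leb \o xsection A) x)%E.
  apply: (@le_trans _ _ (\int[M1]_(x in I01) (leb \o xsection A) x)%E); last first.
    apply: ge0_subset_integral => //; exact: measurable_fun_xsection.
  apply: (@le_trans _ _ (\int[M1]_(x in I01) (cst c%:E) x)%E).
    by rewrite integral_cst// /M1 /= /m1 /mrestr setIid.
  apply: ge0_le_integral => //.
  - by move=> *; rewrite lee_fin ltW.
  - by apply: measurable_funTS; exact: measurable_fun_xsection.
  move=> x; rewrite /I01 /= in_itv /= => x01.
  set Ex := [set t | periodization B (x + t)%R].
  have mEx : measurable Ex.
    rewrite /Ex; under eq_set do rewrite addrC.
    exact: measurable_preimage_shift (measurable_periodization mB).
  have -> : xsection A x = T k `&` Ex.
    by apply/seteqP; split => t; rewrite /xsection /= inE => -[] //= ? [] //.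
  have := lebesgue_periodization mB B01 x01; rewrite -/Ex.
  have m01 : measurable (`[0, 1[%classic : set R) by exact: measurable_itv.
  (* All lengths involved are finite; passing to real numbers by [fine] turns the
     inclusion-exclusion argument into linear arithmetic. *)
  have DIE (D : set R) : measurable D -> D `<=` `[0, 1[%classic ->
      fine (leb D) = fine (leb (D `\` Ex)) + fine (leb (D `&` Ex)).
    move=> mD D01; apply: EFin_inj; rewrite EFinD !fin01//; first exact: measureDI.
    - exact: measurableI.
    - exact: subset_trans (@subIsetl _ _ _) D01.
    - exact: measurableD.
    - exact: subset_trans (@subDsetl _ _ _) D01.
  have leF (D D' : set R) : measurable D -> D `<=` `[0, 1[%classic ->
      measurable D' -> D' `<=` `[0, 1[%classic ->
      (leb D <= leb D')%E -> fine (leb D) <= fine (leb D').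
    by move=> mD D01 mD' D01' DD'; rewrite -lee_fin !fin01.
  have mTE := measurableI _ _ mTk mEx; have mTD := measurableD mTk mEx.
  have mIE := measurableI _ _ m01 mEx; have mID := measurableD m01 mEx.
  have TE01 := subset_trans (@subIsetl _ (T k) Ex) T01.
  have TD01 := subset_trans (@subDsetl _ (T k) Ex) T01.
  move=> /(leF _ _ mB B01 mIE (@subIsetl _ _ _)) BIE.
  have TD : fine (leb (T k `\` Ex)) <= fine (leb (`[0%R, 1%R[%classic `\` Ex)).
    apply: leF => //.
    by apply: le_measure; [exact: mem_set|exact: mem_set|apply: setSD; exact: T01].
  rewrite -fin01// lee_fin.
  have := DIE _ mTk T01; have := DIE _ m01 (@subset_refl _ _).
  by rewrite lebesgue_measure_itv01 /c /=; lra.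
have : (mu I01 <= (c^-1)%:E * k%:R%:E)%E.
  by rewrite lee_pdivlMl//; apply: le_trans lb _; rewrite FG.
by move=> /le_lt_trans; apply; rewrite -EFinM ltry.
Qed.
End Finiteness.

(** * Norm estimates and membership in the lattice *)

Section Lattice.
Context {R : realType}.
Local Open Scope complex_scope.
Implicit Types (A B : set R) (f g : R -> R[i]).

(** Every point has an integer translate in [[0, 1)], and a 1-periodic [P] does not distinguish
    between translates. *)
Lemma perchi_setI01 (P : set R) x : (forall k : int, P (x + k%:~R) = P x) ->
  perchi (I01 `&` P) x = `[< P x >]%:R :> R[i].
Proof.
move=> PD; rewrite /perchi indicE; congr (_%:R); congr nat_of_bool.
apply/idP/idP; rewrite inE.
  by move=> -[k [_]]; rewrite PD => Px; exact/asboolP.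
move=> /asboolP Px; exists (- Num.floor x); split; last by rewrite PD.
have := floor_itv x; rewrite rmorphD rmorphN /= /I01 /= in_itv /=.
by move=> /andP[? ?]; apply/andP; split; lra.
Qed.

Lemma within_continuous_measurable f :
  {within I01, continuous (f : R -> R[i]^o)} ->
  measurable_fun I01 (fun x => complex.Re (f x)) /\
  measurable_fun I01 (fun x => complex.Im (f x)).
Proof.
move=> cf.
have near_le (x : R) (e : R) : 0 < e ->
    \forall y \near (nbhs (x : subspace I01)), `|f x - f y| <= e%:C.
  move=> e0; have := cf x => /(@cvgrPdist_le R[i] R[i]^o); apply.
  by rewrite ltcR.
split; apply: subspace_continuous_measurable_fun; try exact: measurable_I01.
  move=> x; apply/(@cvgrPdist_le _ R^o) => e e0; apply: filterS (near_le x e e0) => y.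
  by move=> /norm_Re_le; rewrite raddfB.
move=> x; apply/(@cvgrPdist_le _ R^o) => e e0; apply: filterS (near_le x e e0) => y.
by move=> /norm_Im_le; rewrite raddfB.
Qed.

Context (mu : {measure set R -> \bar R}).
Context (X : set (R -> R[i])) (nm : (R -> R[i]) -> R).
Hypothesis BL : banach_lattice mu X nm.

Lemma le_nm f g : X f -> X g -> (forall x, `|f x| <= `|g x|) -> nm f <= nm g.
Proof. by move=> Xf Xg fg; apply: (bl_mono BL) => //; apply: aeW => x _. Qed.

(** Homogeneity with scalar 0 gives the zero function norm 0, and monotonicity compares it with
    [f]. *)
Lemma nm_ge0 f : X f -> 0 <= nm f.
Proof.
move=> Xf; rewrite -[0](mul0r (nm f)) -(@Normc.normc0 R) -(bl_normZ BL)//.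
by apply: le_nm => [|//|x]; [exact: (bl_scale BL)|rewrite mul0r normr0].
Qed.

Lemma nmZ (c : R) f : 0 <= c -> X f -> nm (fun x => c%:C * f x) = c * nm f.
Proof.
move=> c0 Xf; rewrite (bl_normZ BL)//; congr (_ * _).
by rewrite /= expr0n addr0 sqrtr_sqr ger0_norm.
Qed.

Lemma X_sub f g : X f -> X g -> X (fun x => f x - g x).
Proof.
move=> Xf Xg; rewrite (_ : (fun x => _) = (fun x => f x + -1 * g x)).
  by apply: (bl_add BL) => //; exact: (bl_scale BL).
by apply/funext => x; rewrite mulN1r.
Qed.

(** The function [f0] witnesses that [X] is nonempty, so that the empty sum, as [0 * f0], belongs to
    [X]. *)
Lemma X_nm_sum (f0 : R -> R[i]) (I : Type) (r : seq I) (F : I -> R -> R[i]) :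
  X f0 -> (forall i, X (F i)) ->
  X (fun x => \sum_(i <- r) F i x) /\
  nm (fun x => \sum_(i <- r) F i x) <= \sum_(i <- r) nm (F i).
Proof.
move=> Xf0 XF; elim: r => [|i r [IHX IHr]].
  have -> : (fun x => \sum_(i <- [::]) F i x) = (fun x => 0%:C * f0 x).
    by apply/funext => x; rewrite big_nil mul0r.
  by rewrite nmZ// mul0r big_nil; split => //; exact: (bl_scale BL).
have -> : (fun x => \sum_(j <- i :: r) F j x) =
    (fun x => F i x + \sum_(j <- r) F j x).
  by apply/funext => x; rewrite big_cons.
split; first exact: (bl_add BL).
by rewrite big_cons; apply: le_trans (bl_normD BL _ _) _ => //; rewrite lerD2l.
Qed.

Lemma X_measurable f : X f ->
  measurable_fun I01 (fun x => complex.Re (f x)) /\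
  measurable_fun I01 (fun x => complex.Im (f x)).
Proof.
move=> /(bl_L1 BL)[/integrableP[mr _] /integrableP[mi _]].
by split; exact/measurable_EFinP.
Qed.

Lemma measurable_normc f : measurable_fun I01 (fun x => complex.Re (f x)) ->
  measurable_fun I01 (fun x => complex.Im (f x)) ->
  measurable_fun I01 (fun x => Normc.normc (f x)).
Proof.
move=> mr mi; rewrite (_ : (fun x => _) = @Num.sqrt R \o
    (fun x => complex.Re (f x) ^+ 2 + complex.Im (f x) ^+ 2)).
  apply: measurableT_comp; first exact: continuous_measurable_fun (@sqrt_continuous R).
  by apply: measurable_funD; exact: measurable_funX.
by apply/funext => x /=; case: (f x).
Qed.

(** If [B] has finite measure, every translate of [perchi B] is in [X], hence in [L_1], and its
    integral is the measure of the translated set. *)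
Lemma finite_I01 : sigma_finite I01 mu -> translation_invariant X nm ->
  (mu I01 < +oo)%E.
Proof.
move=> sf TI; apply: finite_measure_of_translates => // B mB B01 Boo t.
have mI := @measurable_I01 R.
have [Xt _] := TI t _ (bl_chi BL mB B01 Boo).
have [/integrableP[_] + _] := bl_L1 BL Xt.
have mE : measurable [set x | periodization B (x + t)].
  exact: (measurable_preimage_shift _ (measurable_periodization mB)).
rewrite (eq_integral (fun x => (\1_[set x | periodization B (x + t)] x)%:E)).
  by rewrite integral_indic// setIC.
move=> x _; rewrite /perchi !indicE /=.
have -> : (x + t \in periodization B) = (x \in [set x | periodization B (x + t)]).
  by apply/idP/idP; rewrite !inE.
by case: (_ \in _); rewrite /= ?normr1 ?normr0.
Qed.

(** This turns a pointwise bound by translates into a norm bound: each translate of [|g|] has norm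
    at most [nm g]. Membership of [|g|] in [X] is a separate hypothesis, as it is not among the
    axioms of [banach_lattice]. *)
Lemma nm_le_shifts f g (s : nat -> R) (M : nat) (L : R) :
  translation_invariant X nm -> 0 <= L -> X f -> X g -> X (fun x => `|g x|) ->
  (forall x, `|f x| <= L%:C * \sum_(i < M) `|g (x + s i)|) ->
  nm f <= L * M%:R * nm g.
Proof.
move=> TI L0 Xf Xg Xg' fg.
pose F i x := `|g (x + s i)|.
have XF i : X (F i) by have [] := TI (s i) _ Xg'.
have nF i : nm (F i) <= nm g.
  by have [_ ->] := TI (s i) _ Xg'; apply: le_nm => // x; rewrite normr_id.
have [XS nS] := X_nm_sum (index_enum 'I_M) Xf XF.
apply: (@le_trans _ _ (nm (fun x => L%:C * \sum_(i < M) F i x))).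
  apply: le_nm => [//||x]; first exact: (bl_scale BL).
  apply: le_trans (fg x) (real_ler_norm _).
  by rewrite ger0_real// mulr_ge0 ?ler0c// sumr_ge0.
rewrite nmZ// -mulrA ler_wpM2l//; apply: le_trans nS _.
apply: (@le_trans _ _ (\sum_(i < M) nm g)); first by apply: ler_sum => i _.
by rewrite sumr_const card_ord mulr_natl.
Qed.

Hypothesis I01oo : (mu I01 < +oo)%E.

Lemma X_perchi B : measurable B -> B `<=` I01 -> X (perchi B).
Proof.
move=> mB B01; apply: (bl_chi BL) => //; apply: le_lt_trans I01oo.
by apply: le_measure; rewrite ?inE//; exact: measurable_I01.
Qed.

Lemma X_cst (c : R[i]) : X (fun=> c).
Proof.
have := bl_scale BL c (X_perchi measurable_I01 (@subset_refl _ _)).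
congr (X _); apply/funext => x.
rewrite -[I01]setIT perchi_setI01//.
by case: asboolP => [_|[]]//; rewrite mulr1.
Qed.

(* By completeness [u] converges in norm to some [g] in [X].  On the set [E m] where
   [f] and [g] differ by at least [1/(m+1)], eventually [|u k - g|] is at least
   [1/(2(m+1))]; so [E m] is negligible and [f = g] almost everywhere. *)
Lemma X_uniform_limit (u : nat -> R -> R[i]) f :
  (forall k, X (u k)) -> periodic f 1 ->
  measurable_fun I01 (fun x => complex.Re (f x)) ->
  measurable_fun I01 (fun x => complex.Im (f x)) ->
  (forall k x, `|u k x - f x| <= (k.+1%:R^-1)%:C) -> X f.
Proof.
move=> Xu perf mrf mif uf.
have nm1 := nm_ge0 (X_cst 1).
have [e e0|g Xg ug] := bl_complete BL Xu.
  (* From index [M] on, two terms differ by at most [2 / (M + 1)] everywhere; monotonicity against a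
     constant function makes [u] a Cauchy sequence in norm. *)
  have [M Me] : exists M : nat, 2 * nm (fun=> 1) / e < M.+1%:R.
    by eexists; exact: truncnS_gt.
  exists M => k l Mk Ml.
  apply: (@le_lt_trans _ _ ((2 / M.+1%:R) * nm (fun=> 1))); last first.
    by rewrite mulrAC ltr_pdivrMr// -ltr_pdivrMl// mulrC.
  rewrite -nmZ ?divr_ge0//; last exact: X_cst.
  apply: le_nm => [||x]; [exact: X_sub|exact: X_cst|].
  rewrite mulr1 norm_real_complex [in leRHS]ger0_norm ?divr_ge0//.
  rewrite -(subrKA (f x)); apply: le_trans (ler_normD _ _) _.
  rewrite [`|f x - _|]distrC.
  apply: le_trans (lerD (uf k x) (uf l x)) _.
  rewrite -rmorphD /= lecR.
  have h i : (M <= i)%N -> i.+1%:R^-1 <= M.+1%:R^-1 :> R.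
    by move=> Mi; rewrite lef_pV2 ?posrE// ler_nat.
  by rewrite mulr_natl mulr2n lerD ?h.
have perg := bl_periodic BL Xg.
have [mrg mig] := X_measurable Xg.
pose d (x : R) : R := Normc.normc (f x - g x).
have perd (k : int) x : d (x + k%:~R) = d x by rewrite /d !periodicz.
have md : measurable_fun I01 d.
  apply: (@measurable_normc (fun x => f x - g x)).
    rewrite (_ : (fun x => _) = (fun x => complex.Re (f x) - complex.Re (g x))).
      exact: measurable_funB.
    by apply/funext => x; rewrite raddfB.
  rewrite (_ : (fun x => _) = (fun x => complex.Im (f x) - complex.Im (g x))).
    exact: measurable_funB.
  by apply/funext => x; rewrite raddfB.
pose E (m : nat) := I01 `&` [set x | m.+1%:R^-1 <= d x].
have XE m : X (perchi (E m)).
  apply: X_perchi; last exact: subIsetl.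
  by apply: measurable_fun_le => //; exact: measurable_I01.
have EE m x : perchi (E m) x = (m.+1%:R^-1 <= d x)%R%:R.
  rewrite perchi_setI01; last by move=> k /=; rewrite perd.
  by congr (nat_of_bool _)%:R; apply/idP/idP => [/asboolP|?]; [|exact/asboolP].
have nmE m : nm (perchi (E m)) = 0.
  apply/le_anti; rewrite (nm_ge0 (XE m)) andbT.
  have : \forall k \near \oo,
      (2 * m.+1%:R)^-1 * nm (perchi (E m)) <= nm (fun x => u k x - g x).
    near=> k.
    rewrite -nmZ//; apply: le_nm => [||x]; [exact: (bl_scale BL)|exact: X_sub|].
    rewrite EE normrM norm_real_complex [`|_^-1|]ger0_norm//.
    have [dm|_] := leP m.+1%:R^-1 (d x); last by rewrite normr0 mulr0.
    rewrite normr1 mulr1.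
    have dE : `|f x - g x| = (d x)%:C by exact: norm_normc.
    have : (d x)%:C <= `|u k x - g x| + (k.+1%:R^-1)%:C.
      rewrite -dE -(subrKA (u k x)) addrC; apply: le_trans (ler_normD _ _) _.
      by rewrite lerD2l distrC.
    rewrite -lerBlDr; apply: le_trans; rewrite -rmorphB /= lecR.
    (* For large [k] the uniform error is at most half of [1/(m + 1)], which leaves the other half
       for [|u k - g|] on [E m]. *)
    have : k.+1%:R^-1 <= (2 * m.+1%:R)^-1 :> R.
      rewrite lef_pV2 ?posrE ?mulr_gt0// -natrM ler_nat.
      by near: k; exists (2 * m.+1)%N => // k /= /leqW.
    rewrite invfM; move: dm; move: (d x) (k.+1%:R^-1) (m.+1%:R^-1) => a b c; lra.
  move=> /(ler_cvg_to (cvg_cst _) ug); by rewrite pmulr_rle0.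
apply: (bl_ae BL Xg) => //.
have : {ae mu, forall x : R, forall m, I01 x -> perchi (E m) x = 0}.
  by apply: ae_foralln => m; exact/(bl_norm0 BL (XE m)).
apply: filterS => x Ex Ix; apply/esym/eqP; rewrite -subr_eq0.
apply/negPn/negP => fg.
have d0 : 0 < d x by rewrite -ltcR -norm_normc normr_gt0.
(* If [d x > 0], then [x] lies in [E m] for [m] the integer part of [1 / d x]. *)
have := Ex (Num.trunc (d x)^-1) Ix; rewrite EE.
rewrite (_ : (_ <= _) = true) => [/eqP|]; first by rewrite oner_eq0.
by rewrite -[leRHS]invrK lef_pV2 ?posrE ?invr_gt0//; exact/ltW/truncnS_gt.
Unshelve. all: by end_near. Qed.

(** [u k] is [f] rounded down to a multiple of [1/(k + 1)], written as a sum of indicators of the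
    level sets [f >= (j + 1)/(k + 1)]. The bound [K] makes the sum finite, and the error is at most
    [1/(k + 1)] everywhere. *)
Lemma X_bounded_ge0 (f : R -> R) (K : R) : periodic f 1 -> measurable_fun I01 f ->
  (forall x, 0 <= f x <= K) -> X (fun x => (f x)%:C).
Proof.
move=> perf mf fK.
pose J k := (Num.trunc (K * k.+1%:R)).+1.
pose E k j := I01 `&` [set x | j.+1%:R / k.+1%:R <= f x].
pose u k x : R[i] := \sum_(j < J k) ((k.+1%:R^-1)%:C * perchi (E k j) x).
apply: (@X_uniform_limit u) => //.
- move=> k; apply: (X_nm_sum _ (X_cst 0) _).1 => j.
  apply: (bl_scale BL); apply: X_perchi; last exact: subIsetl.
  by apply: measurable_fun_le => //; exact: measurable_I01.
- by move=> x; rewrite perf.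
move=> k x; have /andP[f0 fxK] := fK x.
pose y := f x * k.+1%:R; have y0 : 0 <= y by rewrite mulr_ge0.
have yJ : (Num.trunc y <= J k)%N.
  by apply/leqW/le_truncn; rewrite ler_wpM2r.
have -> : u k x = ((Num.trunc y)%:R / k.+1%:R)%:C.
  rewrite /u -mulr_sumr mulrC rmorphM /=; congr (_ * _).
  rewrite (eq_bigr (fun j : 'I_(J k) => (j < Num.trunc y)%N%:R)).
    rewrite -natr_sum -big_mkcond /= -(big_ord_widen _ (fun=> 1%N))// sum1_card card_ord.
    by rewrite rmorph_nat.
  move=> j _; rewrite perchi_setI01; last by move=> l /=; rewrite (periodicz _ _ perf).
  congr (nat_of_bool _)%:R; rewrite /= ler_pdivrMr// -/y.
  rewrite -truncn_ge_nat//; apply/idP/idP => [/asboolP|?]; [by []|exact/asboolP].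
rewrite -rmorphB norm_real_complex lecR.
have /andP[h1 h2] := truncn_itv y0.
rewrite -(ler_pM2r (ltr0Sn R k)) mulVf ?pnatr_eq0//.
rewrite -[X in _ * X <= _](gtr0_norm (ltr0Sn R k)) -normrM mulrBl divfK ?pnatr_eq0// -/y.
by move: h2; rewrite -natr1 ler_norml => h2; apply/andP; split; lra.
Qed.

(** The real and imaginary parts are made nonnegative by adding the constant [K]. *)
Lemma X_bounded f (K : R) : periodic f 1 ->
  measurable_fun I01 (fun x => complex.Re (f x)) ->
  measurable_fun I01 (fun x => complex.Im (f x)) ->
  (forall x, `|f x| <= K%:C) -> X f.
Proof.
move=> perf mr mi fK.
have H (g : R -> R) : periodic g 1 -> measurable_fun I01 g ->
    (forall x, `|g x| <= K) -> X (fun x => (g x)%:C).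
  move=> perg mg gK.
  have -> : (fun x => (g x)%:C) = (fun x => (g x + K)%:C + (- K)%:C).
    by apply/funext => x; rewrite -rmorphD /= addrK.
  apply: (bl_add BL); last exact: X_cst.
  apply: (@X_bounded_ge0 _ (K + K)).
  - by move=> x; rewrite perg.
  - exact: measurable_funD.
  - by move=> x; have := gK x; rewrite ler_norml => /andP[? ?]; apply/andP; split; lra.
have -> : f = (fun x => (complex.Re (f x))%:C + 'i%C * (complex.Im (f x))%:C).
  by apply/funext => x; exact: complexE.
apply: (bl_add BL); last apply: (bl_scale BL); apply: H => //.
- by move=> x; rewrite perf.
- by move=> x; exact: norm_Re_le.
- by move=> x; rewrite perf.
- by move=> x; exact: norm_Im_le.
Qed.

Lemma X_norm f (K : R) : X f -> (forall x, `|f x| <= K%:C) -> X (fun x => `|f x|).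
Proof.
move=> Xf fK; have [mr mi] := X_measurable Xf.
apply: (@X_bounded _ K) => [x|||x].
- by rewrite (bl_periodic BL Xf).
- by under eq_fun do rewrite norm_normc; exact: measurable_normc.
- by under eq_fun do rewrite norm_normc /=; exact: measurable_cst.
- by rewrite normr_id.
Qed.

End Lattice.

(** * The two-sided norm estimate *)

Theorem theorem6p6 (R : realType) (mu : {measure set R -> \bar R})
    (X : set (R -> R[i])) (nm : (R -> R[i]) -> R) (r : nat) (eps : R) :
  sigma_finite (I01 (R := R)) mu ->
  banach_lattice mu X nm ->
  translation_invariant X nm ->
  (2 <= r)%N ->
  0 < eps ->
  exists c C : R, [/\ 0 < c, 0 < C &
    forall (n N : nat) (S : R -> R[i]) (x : 'I_N -> R),
      (0 < n)%N ->
      (2 * r%:R ^+ 2 + eps) * n%:R <= N%:R :> R ->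
      spline r n S ->
      (forall k : 'I_N, subitv N k (x k)) ->
      [/\ X S, X (stepfun x S),
          c * nm S <= nm (stepfun x S) &
          nm (stepfun x S) <= C * nm S]].
Proof.
move=> sf BL TI r2 eps0; have I01oo := finite_I01 BL sf TI.
have [dl [M [L [L0 SL]]]] := @spline_bound R r r2.
have LM0 : 0 < L * M.+1%:R by rewrite mulr_gt0.
(* [M.+1] in place of [M] makes the constants positive whatever [M] is. *)
exists (L * M.+1%:R)^-1, (2 * (L * M.+1%:R)); split.
- by rewrite invr_gt0.
- by rewrite mulr_gt0.
move=> n N S x n0 nN Sp xN.
have nR : 0 < n%:R :> R by rewrite ltr0n.
have r0 : 0 < r%:R :> R by rewrite ltr0n ltnW.
have rn0 : 0 < 2 * r%:R ^+ 2 * n%:R :> R by rewrite !mulr_gt0// exprn_gt0.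
have rnN : 2 * r%:R ^+ 2 * n%:R <= N%:R :> R.
  by apply: le_trans nN; rewrite ler_pM2r// lerDl ltW.
have NR : 0 < N%:R :> R := lt_le_trans rn0 rnN.
have N0 : (0 < N)%N by rewrite -(ltr0n R).
(* A sample point is displaced by at most [1/N], hence is an admissible perturbation of a node in
   [spline_bound]. *)
have Nrn : N%:R^-1 <= (2 * r%:R ^+ 2 * n%:R)^-1 :> R by rewrite lef_pV2.
have Nn : N%:R^-1 <= n%:R^-1 :> R.
  rewrite lef_pV2 ?posrE//; apply: le_trans rnN; rewrite ler_peMl ?ltW//.
  by have : 2 <= r%:R :> R; [rewrite ler_nat|nra].
have [SC _ perS] := Sp.
have [K SK] := spline_bounded r2 n0 Sp.
have [mrS miS] : measurable_fun I01 (fun y => complex.Re (S y)) /\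
    measurable_fun I01 (fun y => complex.Im (S y)).
  by apply: within_continuous_measurable; case: (r - 2)%N SC => [|m] [].
have XS : X S := X_bounded BL I01oo perS mrS miS SK.
have XnS := X_norm BL I01oo XS SK.
have XT : X (stepfun x S).
  apply: (X_nm_sum BL _ XS _).1 => k; apply: (bl_scale BL).
  apply: (X_perchi BL I01oo); first exact: measurable_itv.
  apply: subset_itv; rewrite bnd_simp; first by rewrite divr_ge0.
  by rewrite ler_pdivrMr// mul1r ler_nat.
have T0 y : 0 <= stepfun x S y by exact: stepfun_ge0.
have XnT : X (fun y => `|stepfun x S y|).
  by rewrite (_ : (fun y => _) = stepfun x S)//; apply/funext => y; rewrite ger0_norm.
pose s i : R := (i%:R * dl - 3) / n%:R.
split => //.
- rewrite ler_pdivrMl//; apply: (@le_trans _ _ (L * M%:R * nm (stepfun x S))).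
    apply: (@nm_le_shifts _ _ _ _ BL _ _ s) => //; first exact: ltW.
    (* The nodes are sample points, up to integers, chosen within [1/N] of each [y + s i], where
       [|S|] is at most the step function at [y + s i]; [spline_bound] is used with [x = t = y]. *)
    move=> y; have zP i : exists z, `|z - (y + s i)| <= N%:R^-1 /\
        `|S z| <= stepfun x S (y + s i).
      by have [z ? ?] := stepfun_ge (y + s i) N0 perS xN; exists z.
    have [z {}zP] := choice zP.
    apply: (le_trans (SL n S y y z n0 Sp _ _)).
    + by rewrite subrr normr0 invr_ge0 ltW.
    + by move=> i; have [+ _] := zP i; move=> /le_trans; apply.
    rewrite ler_wpM2l ?ler0c ?(ltW L0)//; apply: ler_sum => i _.
    by rewrite (ger0_norm (T0 _)); case: (zP i).
  by rewrite ler_wpM2r ?(nm_ge0 BL XT)// ler_pM2l// ler_nat.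
- apply: (@le_trans _ _ (2 * L * M%:R * nm S)).
    apply: (@nm_le_shifts _ _ _ _ BL _ _ s) => //; first by rewrite mulr_ge0// ltW.
    move=> y; rewrite ger0_norm// rmorphM /= rmorph_nat -mulrA.
    apply: stepfun_le => //.
      by rewrite mulr_ge0 ?ler0c ?(ltW L0)// sumr_ge0.
    (* Here the nodes [y + s i] are exact and the point of evaluation moves instead: the same sum
       bounds [|S z|] for all [z] within [1/N <= 1/n] of [y]. *)
    move=> z zy; apply: (SL n S y z (fun i => y + s i) n0 Sp).
      exact: le_trans Nn.
    by move=> i; rewrite subrr normr0 invr_ge0 ltW.
  by rewrite ler_wpM2r ?(nm_ge0 BL XS)// -mulrA ler_pM2l// ler_pM2l// ler_nat.
Qed.
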